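(* Let $(\mathcal{R},\mu)$ be a $\sigma$-finite resonant measure space and let $\phi\colon\mathcal{R}\to\mathcal{R}$ satisfy condition (I), i.e. $\phi$ is power-measure-bounded and at least one of the following holds: (a) $\mu(\phi^{-1}(E))\le\mu(E)$ for every measurable $E\subseteq\mathcal{R}$; (b) there is $C>0$ such that $C\mu(E)\le\mu(\phi^{-i}(E))$ for every $i\in\mathbb{N}$ and every measurable $E\subseteq\mathcal{R}$. Then the maximal ergodic operator $T_\phi^{\#}$ is well defined and bounded as $T_\phi^{\#}\colon L^1\to L^{1,\infty}$, i.e. there is a constant $K<\infty$ such that $\lVert T_\phi^{\#}f\rVert_{L^{1,\infty}}\le K\lVert f\rVert_{L^1}$ for all $f\in L^1$.
   Context: A $\sigma$-finite measure space is resonant if $\sup_{\tilde g^*=g^*}\int_{\mathcal{R}}|f\tilde g|\,d\mu=\int_0^\infty f^*g^*\,d\lambda$ for all measurable $f,g$, where $f^*(t)=\inf\{s\ge0:\mu(\{|f|>s\})\le t\}$ and $\lambda$ is Lebesgue measure (equivalently, the space is non-atomic, or completely atomic with all atoms of equal measure). A measurable $\phi\colon\mathcal{R}\to\mathcal{R}$ is power-measure-bounded if there is $A\in(0,\infty)$ with $\mu(\phi^{-n}(E))\le A\,\mu(E)$ for all $n\ge1$ and all measurable $E$, where $\phi^{-n}(E)$ is the preimage of $E$ under the $n$-fold composition $\phi^n$. $\mathbb{N}$ contains $0$. With $T_\phi f=f\circ\phi$, the maximal ergodic operator is defined on extended complex-valued measurable functions by $$T_\phi^{\#}(f)=\sup_{n\ge1}\frac1n\sum_{i=0}^{n-1}|T_\phi^i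 f|\quad\text{(pointwise)}.$$ $L^{1,\infty}$ is the weak $L^1$ space over $(\mathcal{R},\mu)$ with quasinorm $\lVert f\rVert_{L^{1,\infty}}=\sup_{s>0}s\,\mu(\{|f|>s\})$. *)

(* Defs.v *)
From HB Require Import structures.
From mathcomp Require Import all_boot all_order all_algebra.
From mathcomp Require Import complex.
From mathcomp Require Import all_classical all_reals all_analysis.

Set Implicit Arguments.
Unset Strict Implicit.
Unset Printing Implicit Defensive.

Import Order.TTheory GRing.Theory Num.Theory.
Import numFieldNormedType.Exports.

Local Open Scope classical_set_scope.
Local Open Scope ring_scope.
Local Open Scope ereal_scope.

(* The extended complex numbers, as the Riemann sphere: [Some z] is the finite
   value [z] and [None] is infinity, of modulus [+oo].  The alias [R[i]^o] gives
   [R[i]] its usual topology, induced by the modulus. *)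
Definition ecomplex (R : realType) : Type :=
  one_point_compactification (R[i]^o).

HB.instance Definition _ (R : realType) := PointedTopological.on (ecomplex R).

Definition ecnorm (R : realType) (z : ecomplex R) : \bar R :=
  if z is Some w then (ComplexField.Normc.normc w)%:E else +oo.

(* [0, +oo] inside the extended complex numbers. *)
Definition ecomplex_of (R : realType) (x : \bar R) : ecomplex R :=
  if x is r%:E then Some (r%:C)%C else None.

Section functions.
Context {d : measure_display} {T : measurableType d} {R : realType}.
Implicit Types f g : T -> ecomplex R.

Definition ecmeasurable f :=
  measurable_fun [set: T]
    (f : T -> g_sigma_algebraType (@open (ecomplex R))).

Section measure_space.
Variable mu : {measure set T -> \bar R}.

Definition distribution_fun f (s : R) : \bar R :=
  mu [set x | s%:E < ecnorm (f x)].

(* Only meant for [0 <= t]; the infimum of the empty set is [+oo]. *)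
Definition rearrangement f (t : R) : \bar R :=
  ereal_inf [set s%:E | s in [set s : R | (0 <= s)%R /\
                                          distribution_fun f s <= t%:E]].

Definition equimeasurable f g :=
  forall t : R, (0 <= t)%R -> rearrangement f t = rearrangement g t.

(* Products in [0, +oo] follow the convention 0 * oo = 0. *)
Definition resonant :=
  forall f g, ecmeasurable f -> ecmeasurable g ->
    ereal_sup [set \int[mu]_x (ecnorm (f x) * ecnorm (h x)) |
                h in [set h | ecmeasurable h /\ equimeasurable h g]] =
    \int[lebesgue_measure]_(t in `[0%R, +oo[)
      (rearrangement f t * rearrangement g t).

Definition L1norm f : \bar R := \int[mu]_x ecnorm (f x).

Definition weakL1norm f : \bar R :=
  ereal_sup [set s%:E * distribution_fun f s | s in [set s : R | (0 < s)%R]].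

Definition inL1 f := ecmeasurable f /\ L1norm f < +oo.

Definition inWeakL1 f := ecmeasurable f /\ weakL1norm f < +oo.

Definition eq_ae f g := {ae mu, forall x, f x = g x}.

Definition power_measure_bounded (phi : T -> T) :=
  measurable_fun [set: T] phi /\
  exists A : R, (0 < A)%R /\
    forall (n : nat) (E : set T), (1 <= n)%N -> measurable E ->
      mu (iter n phi @^-1` E) <= A%:E * mu E.

Definition condition_I (phi : T -> T) :=
  power_measure_bounded phi /\
  ((forall E : set T, measurable E -> mu (phi @^-1` E) <= mu E) \/
   (exists C : R, (0 < C)%R /\
      forall (i : nat) (E : set T), measurable E ->
        C%:E * mu E <= mu (iter i phi @^-1` E))).

(* The spaces are represented by functions rather than by classes modulo
   a.e. equality, so being well defined includes respecting that equality. *)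
Definition well_defined_L1_weakL1
    (S : (T -> ecomplex R) -> T -> ecomplex R) :=
  (forall f, inL1 f -> inWeakL1 (S f)) /\
  (forall f g, inL1 f -> inL1 g -> eq_ae f g -> eq_ae (S f) (S g)).

Definition bounded_L1_weakL1
    (S : (T -> ecomplex R) -> T -> ecomplex R) :=
  exists K : R, (0 <= K)%R /\
    forall f, inL1 f -> weakL1norm (S f) <= K%:E * L1norm f.

End measure_space.

Definition koopman (phi : T -> T) f : T -> ecomplex R := f \o phi.

Definition maximal_ergodic (phi : T -> T) f (x : T) : ecomplex R :=
  ecomplex_of (ereal_sup
    [set ((n%:R)^-1)%:E *
         \sum_(0 <= i < n) ecnorm (iter i (koopman phi) f x)
    | n in [set n : nat | (1 <= n)%N]]).

End functions.

(* Main.v *)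
From HB Require Import structures.
Require Import Defs.
From mathcomp Require Import all_boot all_order all_algebra.
From mathcomp Require Import complex.
From mathcomp Require Import all_classical all_reals all_analysis.
From mathcomp Require Import measurable_realfun.

(** Write g = |f| and, for a level s > 0, let P_n be the largest of 0 and of the
    excesses g + g o phi + ... + g o phi^(k-1) - k s over k <= n.  Either
    P_n vanishes, or it is attained by an orbit segment of length at least 1;
    removing the first point of that segment gives Hopf's inequality
      P_n + s 1_(P_n > 0) <= P_n o phi + g                          (excess_drift).
    The sets
    E_n = (P_n > 0) increase with n and their union contains the set where the
    maximal function is larger than s, so it is enough to bound s mu(E_n) by a
    constant times the integral of g.

    Under (a), integration against a measure that phi does not increase gives
    int P_n o phi <= int P_n < +oo, and the inequality integrates to
    s mu(E_n) <= int g: this is the maximal ergodic lemma.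

    Under (b) there is no monotonicity, and the inequality is composed with phi^i,
    integrated, and summed over i < M.  The integrals of P_n telescope:
      sum_(i < M) s mu(phi^-i E_n) + int P_n
        <= int P_n o phi^M + sum_(i < M) int g o phi^i.
    Here the left side is at least M C s mu(E_n), and power-measure-boundedness
    bounds the right side by A int P_n + M A int g, once A is taken at least 1.  Dividing by M and letting M
    tend to infinity gives s mu(E_n) <= (A / C) int g.

    Power-measure-boundedness is also what makes P_n integrable in both cases, and
    what makes the preimages of null sets under the iterates null, so that the
    maximal operator respects equality almost everywhere. *)

Set Implicit Arguments.
Unset Strict Implicit.
Unset Printing Implicit Defensive.

Import Order.TTheory GRing.Theory Num.Theory.
Import numFieldNormedType.Exports.

Local Open Scope classical_set_scope.
Local Open Scope ring_scope.
Local Open Scope ereal_scope.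

(** * Measurability in the extended complex plane *)

Section extended_complex.
Context (R : realType).

Lemma normcRE (w : R[i]) : `|w|%R = ((ComplexField.Normc.normc w)%:C)%C.
Proof. by []. Qed.

(** The rays [-oo, c[ generate the Borel sets of the extended reals, and their
    preimages under the modulus are open discs, possibly empty.  Discs avoid infinity,
    so they remain open in the compactification. *)
Lemma measurable_fun_ecnorm d (T : measurableType d) (f : T -> ecomplex R) :
  ecmeasurable f -> measurable_fun [set: T] (fun x => ecnorm (f x)).
Proof.
move=> mf mT; apply: (measurability _ (ErealGenInftyO.measurableE R)) => //.
move=> _ [_ [c ->] <-].
have -> : (fun x => ecnorm (f x)) @^-1` `]-oo, c%:E[ =
    f @^-1` (Some @` [set w : R[i]^o | `|w|%R < (c%:C)%C]%R).
  apply/seteqP; split => x /=; rewrite in_itv/=.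
    case: (f x) => [w|] //=; rewrite lte_fin => wc.
    by exists w => //; rewrite normcRE ltcR.
  by case=> w wc <- /=; rewrite lte_fin -ltcR -normcRE.
apply: mf => //; apply: sub_sigma_algebra.
apply: one_point_compactification_open_some.
have [c0|c0] := ltP 0%R c.
  have -> : [set w : R[i]^o | `|w|%R < (c%:C)%C]%R = ball (0 : R[i]^o)%R (c%:C)%C.
    by apply/seteqP; split => w; rewrite -ball_normE /= sub0r normrN.
  by apply: ball_open; rewrite ltcR.
rewrite (_ : mkset _ = set0); first exact: open0.
apply/seteqP; split => w //= wc; have := le_lt_trans (normr_ge0 _) wc.
by rewrite ltcR ltNge c0.
Qed.

Lemma continuous_ecomplex_of_fin :
  continuous (fun r : R => ecomplex_of r%:E : ecomplex R).
Proof.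
move=> r; apply: (@continuous_comp _ _ _ (fun r : R => (r%:C)%C : R[i]^o)).
  apply/cvgrPdist_lt => e e0.
  have eE : e = ((complex.Re e)%:C)%C by rewrite RRe_real// gtr0_real.
  have e1 : (0 < complex.Re e)%R by rewrite -ltcR -eE.
  near=> t; rewrite -rmorphB/= eE normcRE.
  rewrite /= expr0n addr0 sqrtr_sqr ltcR.
  near: t; move/cvgrPdist_lt : (@cvg_id _ (nbhs r)); exact.
exact: one_point_compactification_some_continuous.
Unshelve. all: by end_near. Qed.

(** The preimage of an open set is an open set of reals, possibly joined with both
    infinities: continuity on the finite part is enough. *)
Lemma ecmeasurable_ecomplex_of d (T : measurableType d) (f : T -> \bar R) :
  measurable_fun [set: T] f -> ecmeasurable (fun x => ecomplex_of (f x)).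
Proof.
move=> mf mT.
apply: (@measurability _ _ T (g_sigma_algebraType (@open (ecomplex R)))
  _ _ (@open (ecomplex R)) erefl) => // _ [U oU <-].
have -> : [set: T] `&` (fun x => ecomplex_of (f x)) @^-1` U =
   [set: T] `&` f @^-1` (EFin @` ((fun r : R => ecomplex_of r%:E) @^-1` U) `|`
    [set y | (y = +oo \/ y = -oo) /\ U None]).
  apply/seteqP; split => x /= [_]; case: (f x) => [r||] /=.
  - by move=> Ur; split => //; left; exists r.
  - by move=> Ur; split => //; right; split => //; left.
  - by move=> Ur; split => //; right; split => //; right.
  - by move=> [[r0 ? [<-]]|[[]]].
  - by move=> [[]//|[]].
  - by move=> [[]//|[]].
apply: mf => //; apply: measurableU.
  apply: measurable_image_EFin; apply: open_measurable.
  by apply: open_comp oU => x _; exact: continuous_ecomplex_of_fin.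
have [UN|UN] := pselect (U None).
  rewrite (_ : mkset _ = [set +oo] `|` [set -oo]).
    by apply: measurableU; exact: emeasurable_set1.
  by apply/seteqP; split=> y /=; tauto.
rewrite (_ : mkset _ = set0) //.
by apply/seteqP; split=> y /=; tauto.
Qed.

End extended_complex.

(** * Hopf's pointwise inequality *)

Section excess.
Context (T : Type) (R : realType) (phi : T -> T) (g : T -> \bar R) (s : R).

(** The maximum of 0 and of the orbit sums of g - s of length at most n.  Peeling
    off the first term of the orbit gives this recursive form, which spares
    indexed maxima. *)
Fixpoint excess (n : nat) (x : T) : \bar R :=
  if n is m.+1 then maxe 0 (g x - s%:E + excess m (phi x)) else 0.

Definition exceeds (n : nat) : set T := [set x | 0 < excess n x].

Lemma excess_ge0 n x : 0 <= excess n x.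
Proof. by case: n => [|n] //=; rewrite le_max lexx. Qed.

Hypothesis g0 : forall x, 0 <= g x.

Lemma excess_nondecreasing n x : excess n x <= excess n.+1 x.
Proof.
elim: n x => [x|n IH x]; first exact: excess_ge0.
rewrite [leLHS]/= [leRHS]/= ge_max !le_max lexx /=.
by rewrite leeD2l ?orbT//; exact: IH.
Qed.

(** Where the excess is positive, it is the first term g - s plus the excess of
    length one less at the next point, which is at most the excess there. *)
Lemma excess_drift n x :
  s%:E * (\1_(exceeds n) x)%:E + excess n x <= excess n (phi x) + g x.
Proof.
rewrite indicE; have [Px|] := ltP 0 (excess n x); last first.
  move=> Px; rewrite memNset ?mule0 ?add0e; last by apply/negP; rewrite -leNgt.
  have -> : excess n x = 0.
    by apply/eqP; rewrite eq_le excess_ge0 andbT.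
  by rewrite adde_ge0// excess_ge0.
rewrite mem_set ?mule1//.
case: n Px => [|n]; first by rewrite /= ltxx.
rewrite [excess n.+1 x]/= lt_max ltxx /= => /ltW /max_idPr -> /=.
rewrite EFinN addeC addeAC subeK// addeC leeD2r//.
exact: excess_nondecreasing.
Qed.

(** This bound puts the points whose average over n steps exceeds s into the set
    [exceeds n]. *)
Lemma excess_ge_orbit_sum n x :
  \sum_(i < n) g (iter i phi x) <= (n%:R * s)%:E + excess n x.
Proof.
elim: n x => [x|n IH x]; first by rewrite big_ord0 mul0r add0e.
rewrite big_ord_recl; under eq_bigr do rewrite lift0 iterSr.
rewrite /=.
have := IH (phi x) => /(leeD2l (g x)) /le_trans; apply.
rewrite addeCA -natr1 mulrDl mul1r EFinD -addeA leeD2l//.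
have : g x - s%:E + excess n (phi x) <=
    maxe 0 (g x - s%:E + excess n (phi x)) by rewrite le_max lexx orbT.
by move=> /(leeD2l s%:E); rewrite addeA [s%:E + _]addeC subeK.
Qed.

(** Integrability of the excess comes from this bound. *)
Lemma excess_le_orbit_sum n x : (0 <= s)%R ->
  excess n x <= \sum_(i < n) g (iter i phi x).
Proof.
move=> s0; elim: n x => [x|n IH x]; first by rewrite big_ord0.
rewrite big_ord_recl; under eq_bigr do rewrite lift0 iterSr.
rewrite /=.
rewrite ge_max adde_ge0 ?sume_ge0//= leeD//.
by rewrite EFinN leeBlDr// leeDl// lee_fin.
Qed.

End excess.

(** * Integrating along the orbits *)

Section maximal_inequality.
Context d (T : measurableType d) (R : realType).
Variable mu : {measure set T -> \bar R}.

Lemma measurable_fun_iter (phi : T -> T) n :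
  measurable_fun [set: T] phi -> measurable_fun [set: T] (iter n phi).
Proof.
move=> mphi; elim: n => [|n IH]; first exact: measurable_id.
exact: measurableT_comp.
Qed.

(** The left side is the integral of f against the image measure of mu by psi, and
    the hypothesis compares this measure with A mu. *)
Lemma ge0_integral_comp_le (psi : T -> T) (A : R) (f : T -> \bar R) :
    measurable_fun [set: T] psi -> (0 <= A)%R ->
    (forall E, measurable E -> mu (psi @^-1` E) <= A%:E * mu E) ->
    measurable_fun [set: T] f -> (forall x, 0 <= f x) ->
  \int[mu]_x f (psi x) <= A%:E * \int[mu]_x f x.
Proof.
move=> mpsi A0 muA mf f0.
have -> : \int[mu]_x f (psi x) = \int[pushforward mu psi]_x f x.
  by rewrite ge0_integral_pushforward.
have <- : \int[mscale (NngNum A0) mu]_x f x = A%:E * \int[mu]_x f x.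
  by rewrite ge0_integral_mscale.
pose mpsi' := isMeasurableFun.Build _ _ _ _ _ mpsi.
pose psi' : {mfun T >-> T} := HB.pack psi mpsi'.
exact: (@ge0_le_measure_integral _ _ _
  (pushforward mu psi') (mscale (NngNum A0) mu)).
Qed.

Lemma ge0_mule_natl_sum (x : \bar R) (M : nat) : 0 <= x ->
  M%:R%:E * x = \sum_(i < M) x.
Proof.
move=> x0; elim: M => [|M IH]; first by rewrite mul0e big_ord0.
by rewrite big_ord_recr -IH -natr1 EFinD ge0_muleDl// ?mul1e// lee_fin.
Qed.

(** Division by M as M tends to infinity. *)
Lemma lee_of_natmul_le (a b c : \bar R) : 0 <= a -> 0 <= c -> b \is a fin_num ->
  (forall M : nat, M%:R%:E * a <= b + M%:R%:E * c) -> a <= c.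
Proof.
move=> a0; case: c => [c|_ _ _|//]; last exact: leey.
move=> c0 + H; case: b H => // b H _.
case: a a0 H => [a|_ /(_ 1%N)|//]; last by rewrite !mul1e.
move=> a0 H; rewrite lee_fin leNgt; apply/negP => ca.
(* If c < a, the bound fails as soon as M (a - c) > b. *)
have ac : (0 < a - c)%R by rewrite subr_gt0.
have := H (Num.truncn (b / (a - c))).+1.
rewrite -!EFinM -EFinD lee_fin -lerBlDr -mulrBr leNgt => /negP; apply.
by rewrite -ltr_pdivrMr// truncnS_gt.
Qed.

Context (phi : T -> T) (g : T -> \bar R) (s : R) (A : R).
Hypothesis mphi : measurable_fun [set: T] phi.
Hypothesis A0 : (0 <= A)%R.
Hypothesis phiA :
  forall n E, measurable E -> mu (iter n phi @^-1` E) <= A%:E * mu E.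
Hypothesis mg : measurable_fun [set: T] g.
Hypothesis g0 : forall x, 0 <= g x.
Hypothesis gfin : \int[mu]_x g x < +oo.
Hypothesis s0 : (0 <= s)%R.

Local Notation P := (excess phi g s).
Local Notation E := (exceeds phi g s).

Lemma measurable_excess n : measurable_fun [set: T] (P n).
Proof.
elim: n => [|n IH] /=; first exact: measurable_cst.
apply: measurable_maxe; first exact: measurable_cst.
apply: emeasurable_funD; last exact: (measurableT_comp IH).
by apply: emeasurable_funD => //; exact: measurable_cst.
Qed.

Lemma measurable_exceeds n : measurable (E n).
Proof.
by rewrite -[E n]setTI; apply: emeasurable_fun_o_infty => //;
  exact: measurable_excess.
Qed.

Let integral_iter_le (f : T -> \bar R) n :
    measurable_fun [set: T] f -> (forall x, 0 <= f x) ->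
  \int[mu]_x f (iter n phi x) <= A%:E * \int[mu]_x f x.
Proof.
move=> mf f0; apply: ge0_integral_comp_le => //; first exact: measurable_fun_iter.
exact: phiA.
Qed.

Let measurable_comp_iter (f : T -> \bar R) n :
  measurable_fun [set: T] f -> measurable_fun [set: T] (f \o iter n phi).
Proof. by move=> mf; apply: measurableT_comp => //; exact: measurable_fun_iter. Qed.

Lemma integral_excess_fin n : \int[mu]_x P n x \is a fin_num.
Proof.
have P0 : 0 <= \int[mu]_x P n x.
  by apply: integral_ge0 => x _; exact: excess_ge0.
rewrite ge0_fin_numE//.
apply: (@le_lt_trans _ _ (\sum_(i < n) A%:E * \int[mu]_x g x)); last first.
  by apply: lte_sum_pinfty => i _; rewrite lte_mul_pinfty.
apply: (@le_trans _ _ (\int[mu]_x \sum_(i < n) g (iter i phi x))).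
  apply: ge0_le_integral => //.
  - by move=> x _; exact: excess_ge0.
  - exact: measurable_excess.
  - apply: (@emeasurable_sum _ _ _ _ _ _ (fun (i : 'I_n) x => g (iter i phi x))) => i.
    exact: (measurable_comp_iter i mg).
  - by move=> x _; exact: excess_le_orbit_sum.
rewrite ge0_integral_sum//; last by move=> i; exact: (measurable_comp_iter i mg).
by apply: lee_sum => i _; exact: integral_iter_le.
Qed.

(** The integral of Hopf's inequality composed with the i-th iterate. *)
Lemma integral_excess_drift n i :
  s%:E * mu (iter i phi @^-1` E n) + \int[mu]_x P n (iter i phi x) <=
  \int[mu]_x P n (iter i.+1 phi x) + \int[mu]_x g (iter i phi x).
Proof.
have mE : measurable (iter i phi @^-1` E n).
  rewrite -[X in measurable X]setTI; apply: measurable_fun_iter => //.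
  exact: measurable_exceeds.
have -> : s%:E * mu (iter i phi @^-1` E n) =
    \int[mu]_x (s%:E * (\1_(E n) (iter i phi x))%:E).
  rewrite (@ge0_integralZl_EFin _ _ _ mu _ measurableT
    (fun x => (\1_(iter i phi @^-1` E n) x)%:E))//.
    by rewrite integral_indic// setIT.
  by apply/measurable_EFinP; exact: measurable_indic.
have mP k : measurable_fun [set: T] (fun x => P n (iter k phi x)).
  exact: (measurable_comp_iter k (measurable_excess n)).
have mi : measurable_fun [set: T]
    (fun x => s%:E * (\1_(E n) (iter i phi x))%:E).
  apply: measurable_funeM.
  apply/measurable_EFinP; apply: (measurable_indic (U := iter i phi @^-1` E n)).
  exact: mE.
rewrite -!ge0_integralD//.
- apply: ge0_le_integral => //.
  + by move=> x _; rewrite adde_ge0 ?excess_ge0// mule_ge0// lee_fin.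
  + exact: emeasurable_funD.
  + by apply: emeasurable_funD => //; exact: (measurable_comp_iter i mg).
  + by move=> x _; exact: excess_drift.
- by move=> x _; rewrite mule_ge0// lee_fin.
- by move=> x _; exact: excess_ge0.
- by move=> x _; exact: excess_ge0.
- exact: (measurable_comp_iter i mg).
Qed.

Lemma integral_excess_telescope n M :
  \sum_(i < M) s%:E * mu (iter i phi @^-1` E n) + \int[mu]_x P n x <=
  \int[mu]_x P n (iter M phi x) + \sum_(i < M) \int[mu]_x g (iter i phi x).
Proof.
elim: M => [|M IH]; first by rewrite !big_ord0 add0e adde0.
rewrite !big_ord_recr/= addeAC.
apply: (le_trans (leeD2r _ IH)).
rewrite addeAC [leRHS]addeA [leRHS]addeAC leeD2r// addeC.
exact: integral_excess_drift.
Qed.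

(** Maximal ergodic lemma: the two integrals of the excess in the integrated
    inequality cancel, because they are finite. *)
Lemma measure_exceeds_le_contraction n :
  (forall B, measurable B -> mu (phi @^-1` B) <= mu B) ->
  s%:E * mu (E n) <= \int[mu]_x g x.
Proof.
move=> phi1; have := integral_excess_drift n 0; rewrite /= => H.
have : \int[mu]_x P n (phi x) <= \int[mu]_x P n x.
  rewrite -[leRHS]mul1e; apply: ge0_integral_comp_le => //.
  - by move=> B mB; rewrite mul1e phi1.
  - exact: measurable_excess.
  - by move=> x; exact: excess_ge0.
move=> /(leeD2r (\int[mu]_x g x)) /(le_trans H).
by rewrite addeC leeD2lE// integral_excess_fin.
Qed.

(** The boundary term in the telescoped inequality stays bounded by A int P_n,
    while the other terms grow linearly in the number M of summands. *)
Lemma measure_exceeds_le_bounded_below n (C : R) : (0 < C)%R ->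
  (forall i B, measurable B -> C%:E * mu B <= mu (iter i phi @^-1` B)) ->
  s%:E * mu (E n) <= (C^-1 * A)%:E * \int[mu]_x g x.
Proof.
move=> C0 phiC.
have G0 : 0 <= \int[mu]_x g x by exact: integral_ge0.
have sE0 : 0 <= s%:E * mu (E n) by rewrite mule_ge0.
rewrite EFinM -muleA lee_pdivlMl//.
apply: (@lee_of_natmul_le _ (A%:E * \int[mu]_x P n x)).
- by rewrite mule_ge0// lee_fin ltW.
- by rewrite mule_ge0// lee_fin.
- by rewrite fin_numM// integral_excess_fin.
move=> M.
apply: (@le_trans _ _ (\sum_(i < M) s%:E * mu (iter i phi @^-1` E n))).
  rewrite ge0_mule_natl_sum; last by rewrite mule_ge0// lee_fin ltW.
  apply: lee_sum => i _; rewrite muleCA lee_wpmul2l ?lee_fin//.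
  by apply: phiC; exact: measurable_exceeds.
apply: (@le_trans _ _
  (\sum_(i < M) s%:E * mu (iter i phi @^-1` E n) + \int[mu]_x P n x)).
  by rewrite leeDl// integral_ge0// => x _; exact: excess_ge0.
apply: (le_trans (integral_excess_telescope n M)); apply: leeD.
  apply: integral_iter_le; first exact: measurable_excess.
  by move=> x; exact: excess_ge0.
rewrite ge0_mule_natl_sum; last by rewrite mule_ge0// lee_fin.
by apply: lee_sum => i _; exact: integral_iter_le.
Qed.

End maximal_inequality.

(** * The maximal function *)

Section maximal_function.
Context d (T : measurableType d) (R : realType).
Implicit Types (phi : T -> T) (g : T -> \bar R).

Definition maximal_function phi g (x : T) : \bar R :=
  ereal_sup [set ((n%:R)^-1)%:E * \sum_(0 <= i < n) g (iter i phi x)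
            | n in [set n : nat | (1 <= n)%N]].

Lemma maximal_function_ge0 phi g x : (forall x, 0 <= g x) ->
  0 <= maximal_function phi g x.
Proof.
move=> g0; apply: ereal_sup_ge; exists (g x) => //; exists 1%N => //.
by rewrite big_nat1 invr1 mul1e.
Qed.

(** The maximal function is the supremum of the tail, from rank 1 on, of the
    sequence of averages. *)
Lemma measurable_maximal_function phi g :
  measurable_fun [set: T] phi -> measurable_fun [set: T] g ->
  measurable_fun [set: T] (maximal_function phi g).
Proof.
move=> mphi mg; apply: (@measurable_fun_esups _ _ _ _
  (fun n x => ((n%:R)^-1)%:E * \sum_(0 <= i < n) g (iter i phi x)) _ 1%N).
move=> n; apply: measurable_funeM; apply: emeasurable_sum => i.
exact: (measurableT_comp mg (measurable_fun_iter i mphi)).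
Qed.

Lemma maximal_function_exceeds phi g (s : R) :
  [set x | s%:E < maximal_function phi g x] `<=`
  \bigcup_n exceeds phi g s n.
Proof.
move=> x /= /ereal_sup_gt[_ [n /= n1 <-] sn]; exists n => //.
have n0 : (0 < n%:R :> R)%R by rewrite ltr0n.
move: sn; rewrite lte_pdivlMl// big_mkord -EFinM => sn.
rewrite /exceeds /=; have := excess_ge_orbit_sum phi g s n x.
by move=> /(lt_le_trans sn); rewrite lteDl.
Qed.

(** Bounds on the increasing sets [exceeds n] pass to their union. *)
Lemma maximal_function_weak_type (mu : {measure set T -> \bar R}) phi g
    (s : R) (B : \bar R) :
  measurable_fun [set: T] phi -> measurable_fun [set: T] g ->
  (forall x, 0 <= g x) -> (0 < s)%R ->
  (forall n, s%:E * mu (exceeds phi g s n) <= B) ->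
  s%:E * mu [set x | s%:E < maximal_function phi g x] <= B.
Proof.
move=> mphi mg g0 s0 HB.
have mE n : measurable (exceeds phi g s n) by exact: measurable_exceeds.
have mU : measurable (\bigcup_n exceeds phi g s n) by exact: bigcupT_measurable.
have cvgU : mu \o exceeds phi g s @ \oo --> mu (\bigcup_n exceeds phi g s n).
  apply: nondecreasing_cvg_mu => //; apply/nondecreasing_seqP => n.
  apply/subsetPset => x; rewrite /exceeds /= => /lt_le_trans; apply.
  exact: excess_nondecreasing.
apply: (@le_trans _ _ (s%:E * mu (\bigcup_n exceeds phi g s n))).
  apply: lee_wpmul2l; first by rewrite lee_fin ltW.
  apply: le_measure; rewrite ?inE//; last first.
    exact: maximal_function_exceeds.
  rewrite -[X in measurable X]setTI; apply: emeasurable_fun_o_infty => //.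
  exact: measurable_maximal_function.
rewrite -lee_pdivlMl// -(cvg_lim _ cvgU)//.
apply: lime_le; first by apply/cvg_ex; eexists; exact: cvgU.
by apply: nearW => n /=; rewrite lee_pdivlMl.
Qed.

End maximal_function.

(** * The maximal ergodic operator *)

Section condition_I.
Context d (T : measurableType d) (R : realType).
Variables (mu : {measure set T -> \bar R}) (phi : T -> T).

(** Replacing A by max 1 A includes the identity among the iterates. *)
Lemma power_measure_bounded_iter : power_measure_bounded mu phi ->
  exists2 A : R, (0 <= A)%R &
    forall n E, measurable E -> mu (iter n phi @^-1` E) <= A%:E * mu E.
Proof.
move=> [_ [A [A0 HA]]]; exists (Num.max 1%R A); first by rewrite le_max ler01.
move=> [|n] E mE; first by rewrite lee_pemull// lee_fin le_max lexx.
apply: (le_trans (HA n.+1 E isT mE)).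
by rewrite lee_wpmul2r// lee_fin le_max lexx orbT.
Qed.

Lemma maximal_ergodic_theorem : condition_I mu phi ->
  exists2 K : R, (0 <= K)%R &
    forall (g : T -> \bar R) (s : R), measurable_fun [set: T] g ->
      (forall x, 0 <= g x) -> \int[mu]_x g x < +oo -> (0 < s)%R ->
      s%:E * mu [set x | s%:E < maximal_function phi g x] <=
      K%:E * \int[mu]_x g x.
Proof.
move=> [pmb HI]; have [mphi _] := pmb.
have [A A0 HA] := power_measure_bounded_iter pmb.
case: HI => [Ha|[C [C0 HC]]].
- exists 1%R => // g s mg g0 gfin s0; rewrite mul1e.
  apply: maximal_function_weak_type => // n.
  by apply: (measure_exceeds_le_contraction mphi A0 HA) => //; exact: ltW.
- exists (C^-1 * A)%R; first by rewrite mulr_ge0// invr_ge0 ltW.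
  move=> g s mg g0 gfin s0; apply: maximal_function_weak_type => // n.
  by apply: (measure_exceeds_le_bounded_below mphi A0 HA) => //; exact: ltW.
Qed.

(** The exceptional set is the union of the preimages of a null set under the
    iterates, each of measure at most A times 0. *)
Lemma ae_orbit (P : T -> Prop) : power_measure_bounded mu phi ->
  {ae mu, forall x, P x} -> {ae mu, forall x, forall i, P (iter i phi x)}.
Proof.
move=> pmb [N [mN N0 PN]]; have [mphi _] := pmb.
have [A _ HA] := power_measure_bounded_iter pmb.
have : mu.-negligible (\bigcup_i iter i phi @^-1` N).
  apply: negligible_bigcup => i; exists (iter i phi @^-1` N); split => //.
    by rewrite -[X in measurable X]setTI; exact: measurable_fun_iter.
  apply/eqP; rewrite eq_le measure_ge0 andbT.
  by apply: (le_trans (HA i N mN)); rewrite N0 mule0.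
apply: negligibleS => x /= /existsNP[i Pi]; exists i => //.
exact: PN.
Qed.

End condition_I.

Section maximal_ergodic_operator.
Context d (T : measurableType d) (R : realType).
Implicit Types (phi : T -> T) (f : T -> ecomplex R).

Lemma ecnorm_ge0 (z : ecomplex R) : 0 <= ecnorm z.
Proof. by case: z => [[a b]|] //=; rewrite lee_fin sqrtr_ge0. Qed.

Lemma ecnorm_ecomplex_of (y : \bar R) : 0 <= y -> ecnorm (ecomplex_of y) = y.
Proof.
case: y => [r||] //=; rewrite lee_fin => r0.
by rewrite expr0n addr0 sqrtr_sqr ger0_norm.
Qed.

Lemma maximal_ergodicE phi f x : maximal_ergodic phi f x =
  ecomplex_of (maximal_function phi (fun y => ecnorm (f y)) x).
Proof.
have koopmanE i y : iter i (koopman phi) f y = f (iter i phi y).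
  by elim: i y => [//|i IH] y; rewrite iterS /koopman /= IH -iterSr.
rewrite /maximal_ergodic; congr (ecomplex_of (ereal_sup _)).
apply: eq_imagel => n _; congr (_ * _).
by apply: eq_bigr => i _; rewrite koopmanE.
Qed.

Lemma ecnorm_maximal_ergodic phi f x : ecnorm (maximal_ergodic phi f x) =
  maximal_function phi (fun y => ecnorm (f y)) x.
Proof.
rewrite maximal_ergodicE ecnorm_ecomplex_of// maximal_function_ge0// => y.
exact: ecnorm_ge0.
Qed.

End maximal_ergodic_operator.

Theorem theorem6p5 (d : measure_display) (T : measurableType d) (R : realType)
    (mu : {sigma_finite_measure set T -> \bar R}) (phi : T -> T)
    (mu_resonant : resonant mu) (phi_I : condition_I mu phi) :
  well_defined_L1_weakL1 mu (maximal_ergodic (R := R) phi) /\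
  bounded_L1_weakL1 mu (maximal_ergodic (R := R) phi).
Proof.
have [pmb _] := phi_I; have [mphi _] := pmb.
have [K K0 HK] := maximal_ergodic_theorem phi_I.
have bound f : inL1 mu f ->
    weakL1norm mu (maximal_ergodic phi f) <= K%:E * L1norm mu f.
  move=> [mf fL1]; apply: ge_ereal_sup => _ [s /= s0 <-].
  rewrite /distribution_fun.
  under eq_set do rewrite ecnorm_maximal_ergodic.
  apply: HK => //; first exact: measurable_fun_ecnorm.
  by move=> x; exact: ecnorm_ge0.
split; last by exists K.
split=> [f fL1|f g _ _ fg].
  split; last first.
    apply: (le_lt_trans (bound f fL1)); rewrite lte_mul_pinfty//.
    by case: fL1.
  rewrite (_ : maximal_ergodic phi f = fun x =>
    ecomplex_of (maximal_function phi (fun y => ecnorm (f y)) x)).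
    apply: ecmeasurable_ecomplex_of; apply: measurable_maximal_function => //.
    by case: fL1 => + _; exact: measurable_fun_ecnorm.
  by apply/funext => x; exact: maximal_ergodicE.
apply: filterS (ae_orbit pmb fg) => x fgx.
rewrite !maximal_ergodicE; congr (ecomplex_of (ereal_sup _)).
apply: eq_imagel => n _; congr (_ * _).
by apply: eq_bigr => i _; rewrite fgx.
Qed.
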